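(* Let $G$ be a strongly topological gyrogroup with a symmetric neighborhood base $\mathscr U$ at $0$ and let $H$ be a second-countable admissible subgyrogroup of $G$ generated from $\mathscr U$. If the quotient space $G/H$ has a star-countable $k$-network, then $G$ also has a star-countable $k$-network.
   Context: All topological spaces are assumed to be Hausdorff. A gyrogroup is a set $G$ with a binary operation $\oplus$ such that: (G1) there is a unique identity element $0\in G$ with $0\oplus a=a=a\oplus 0$ for all $a\in G$; (G2) for each $x\in G$ there is a unique inverse $\ominus x\in G$ with $\ominus x\oplus x=0=x\oplus(\ominus x)$; (G3) for all $x,y\in G$ there is an automorphism $\mathrm{gyr}[x,y]$ of $(G,\oplus)$ with $x\oplus(y\oplus z)=(x\oplus y)\oplus \mathrm{gyr}[x,y](z)$ for all $z\in G$; (G4) $\mathrm{gyr}[x\oplus y,y]=\mathrm{gyr}[x,y]$ for all $x,y\in G$. A topological gyrogroup is a gyrogroup with a topology such that $\oplus:G\times G\to G$ is jointly continuous and $x\mapsto\ominus x$ is continuous. A strongly topological gyrogroup with a symmetric neighborhood base $\mathscr U$ at $0$ is a topological gyrogroup $G$ together with a neighborhood base $\mathscr U$ of $0$ such that for every $U\in\mathscr U$: $\ominus U=U$ and $\mathrm{gyr}[x,y](U)=U$ for all $x,y\in G$. A subgyrogroup of $G$ is a nonempty subset $H$ with $\ominus a\in H$ and $a\oplus b\in H$ for all $a,b\in H$; it is an $L$-subgyrogroup if moreover $\mathrm{gyr}[a,h](H)=H$ for all $a\in G$, $h\in H$. A subgyrogroup $H$ of $G$ is an admissible subgyrogroup generated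 from $\mathscr U$ if there is a sequence $\{U_n:n\in\omega\}$ of open symmetric neighborhoods of $0$ with each $U_n\in\mathscr U$, $U_{n+1}\oplus(U_{n+1}\oplus U_{n+1})\subset U_n$ for each $n\in\omega$, and $H=\bigcap_{n\in\omega}U_n$. Such an $H$ is known to be a closed $L$-subgyrogroup of $G$. For an $L$-subgyrogroup $H$, the set $G/H=\{a\oplus H:a\in G\}$ is a partition of $G$; it carries the quotient topology with respect to $\pi:G\to G/H$, $\pi(a)=a\oplus H$ (i.e. $O\subset G/H$ is open iff $\pi^{-1}(O)$ is open in $G$). Subsets such as $H$ carry the subspace topology. A family $\mathcal P$ of subsets of a space $X$ is a $k$-network for $X$ if whenever $K\subset U$ with $K$ compact and $U$ open in $X$, there is a finite $\mathcal P'\subset\mathcal P$ with $K\subset\bigcup\mathcal P'\subset U$. A family $\mathcal P$ of sets is star-countable if each $P\in\mathcal P$ meets at most countably many members of $\mathcal P$. *)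

(* Defs.v *)
From HB Require Import structures.
From mathcomp Require Import all_boot all_order all_algebra.
From mathcomp Require Import all_classical all_reals all_analysis.

Set Implicit Arguments.
Unset Strict Implicit.
Unset Printing Implicit Defensive.

Local Open Scope classical_set_scope.
Local Open Scope quotient_scope.

Declare Scope gyro_scope.
Delimit Scope gyro_scope with gyro.
Reserved Notation "x ⊕ y" (at level 50, left associativity).
Reserved Notation "⊖ x" (at level 35, right associativity).

(* The gyrations are operations of the structure: left cancellation and
   [gaddA] determine [gyr x y], so this is no extra data. *)
HB.mixin Record isGyrogroup G := {
  gzero : G;
  gadd : G -> G -> G;
  gopp : G -> G;
  gyr : G -> G -> G -> G;
  gadd0l : left_id gzero gadd;
  gadd0r : right_id gzero gadd;
  gzero_uniq : forall e, left_id e gadd -> right_id e gadd -> e = gzero;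
  gaddNl : left_inverse gzero gopp gadd;
  gaddNr : right_inverse gzero gopp gadd;
  gopp_uniq : forall x y, gadd y x = gzero -> gadd x y = gzero -> y = gopp x;
  gyr_morph : forall x y, {morph gyr x y : u v / gadd u v};
  gyr_bij : forall x y, bijective (gyr x y);
  gaddA : forall x y z, gadd x (gadd y z) = gadd (gadd x y) (gyr x y z);
  gyr_loop : forall x y, gyr (gadd x y) y =1 gyr x y
}.

#[short(type="gyrogroupType")]
HB.structure Definition Gyrogroup := {G of isGyrogroup G & Choice G}.

Notation "x ⊕ y" := (gadd x y) : gyro_scope.
Notation "⊖ x" := (gopp x) : gyro_scope.
Local Open Scope gyro_scope.

HB.mixin Record Gyrogroup_isTopological G & Gyrogroup G & Topological G := {
  gadd_continuous : continuous (fun x : G * G => x.1 ⊕ x.2);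
  gopp_continuous : continuous (@gopp G)
}.

#[short(type="topGyrogroupType")]
HB.structure Definition TopologicalGyrogroup :=
  {G of Gyrogroup G & Topological G & Gyrogroup_isTopological G}.

Definition nbhs_base (X : topologicalType) (x : X) (UU : set (set X)) :=
  UU `<=` nbhs x /\ (forall V, nbhs x V -> exists2 U, UU U & U `<=` V).

(* [G] is strongly topological with symmetric neighborhood base [UU] at 0. *)
Definition strongly_topological (G : topGyrogroupType) (UU : set (set G)) :=
  nbhs_base gzero UU /\
  forall U, UU U ->
    (@gopp G) @` U = U /\ (forall x y : G, gyr x y @` U = U).

Definition subgyrogroup (G : gyrogroupType) (H : set G) :=
  [/\ H !=set0, forall a, H a -> H (⊖ a)
    & forall a b, H a -> H b -> H (a ⊕ b)].

Definition gadd_set (G : gyrogroupType) (A B : set G) : set G :=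
  [set a ⊕ b | a in A & b in B].

Definition admissible_subgyrogroup (G : topGyrogroupType)
    (UU : set (set G)) (H : set G) :=
  subgyrogroup H /\
  exists U : nat -> set G,
    [/\ forall n, [/\ open (U n), U n gzero, (@gopp G) @` U n = U n & UU (U n)],
        forall n, gadd_set (U n.+1) (gadd_set (U n.+1) (U n.+1)) `<=` U n
      & H = \bigcap_n U n].

Definition left_coset (G : gyrogroupType) (a : G) (H : set G) : set G :=
  [set a ⊕ h | h in H].

(* The points of [coset_space H] are the sets [a ⊕ H] themselves. *)
Definition coset_space (G : gyrogroupType) (H : set G) : Type :=
  {A : set G | A \in range (fun a : G => left_coset a H)}.

Section CosetSpace.
Context (G : gyrogroupType) (H : set G).

Definition coset_proj (a : G) : coset_space H :=
  exist _ (left_coset a H) (mem_set (imageT (fun a => left_coset a H) a)).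

Definition coset_repr (A : coset_space H) : G :=
  sval (cid2 (set_mem (svalP A))).

Lemma coset_reprK : cancel coset_repr coset_proj.
Proof.
move=> [A HA]; apply: val_inj => /=.
by rewrite /coset_repr /=; case: cid2.
Qed.

HB.instance Definition _ := isQuotient.Build G (coset_space H) coset_reprK.

Lemma coset_piE (a : G) : \pi_(coset_space H) a = coset_proj a.
Proof. by rewrite unlock. Qed.

End CosetSpace.

HB.instance Definition _ (G : topGyrogroupType) (H : set G) :=
  Topological.copy (coset_space H) (quotient_topology (coset_space H)).

Lemma coset_openE (G : topGyrogroupType) (H : set G) (O : set (coset_space H)) :
  open O <-> open (@coset_proj G H @^-1` O).
Proof.
suff -> : @coset_proj G H = \pi_(coset_space H) by [].
by apply/funext => a; rewrite coset_piE.
Qed.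

Definition k_network (X : topologicalType) (P : set (set X)) :=
  forall K U : set X, compact K -> open U -> K `<=` U ->
    exists P' : set (set X),
      [/\ finite_set P', P' `<=` P, K `<=` \bigcup_(A in P') A
        & \bigcup_(A in P') A `<=` U].

Definition star_countable (X : Type) (P : set (set X)) :=
  forall A, P A -> countable [set B | P B /\ A `&` B !=set0].

Definition has_star_countable_k_network (X : topologicalType) :=
  exists P : set (set X), k_network P /\ star_countable P.

(* Main.v *)
(* Let [P] be a star-countable k-network of [G/H] and [pi : G -> G/H].  Each
   [A] in [P] is separable, since the members of [P] meeting it trace a countable
   network on it; [pi] is open and [H] is separable, so some countable [D A] is
   dense around [pi^-1 A].  As [H] is second-countable, a countable [WW `<=` UU]
   controls the neighborhoods of 0 in [H].  The sets
   [pi^-1 A `&` {z | ⊖ y ⊕ z \in W}], with [A] in [P], [y] in [D A] and [W] in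
   [WW], are star-countable because [A] meets countably many members of [P].
   For the k-network property at [x] in [O], pick [W] so small that [W]-closeness
   to [x] and [pi z] close to [pi x] force [z] into [O]; [P] covers the
   [pi]-image of a compact neighborhood [L] of [x] in [K], and, for each of the
   finitely many [A] used, compactness of [L] gives finitely many centers [y]. *)
Require Import Defs.
From mathcomp Require Import all_boot all_order all_algebra.
From mathcomp Require Import all_classical all_reals all_analysis.

Set Implicit Arguments.
Unset Strict Implicit.
Unset Printing Implicit Defensive.

Local Open Scope classical_set_scope.
Local Open Scope gyro_scope.

(** * Gyrogroup algebra: cancellation, balls and cosets *)

Section Gyrogroup.
Context (G : gyrogroupType).
Implicit Types (a b c : G) (A V W H : set G).

Lemma gaddI a : injective (gadd a).
Proof.
move=> b c /(congr1 (gadd (⊖ a))); rewrite !gaddA gaddNl !gadd0l.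
exact: (bij_inj (gyr_bij _ _)).
Qed.

Lemma gyr0l a b : gyr gzero a b = b.
Proof. by apply: (@gaddI a); rewrite -{1}(gadd0l a) -gaddA gadd0l. Qed.

(** The loop axiom turns [gyr (⊖ a) a] into [gyr gzero a], which is the identity. *)
Lemma gaddKl a b : ⊖ a ⊕ (a ⊕ b) = b.
Proof. by rewrite gaddA -gyr_loop gaddNl gyr0l gadd0l. Qed.

Lemma goppK a : ⊖ ⊖ a = a.
Proof. by apply/esym/gopp_uniq; rewrite ?gaddNl ?gaddNr. Qed.

Lemma gaddNKl a b : a ⊕ (⊖ a ⊕ b) = b.
Proof. by rewrite -{1}(goppK a) gaddKl. Qed.

(** Stands in for the group law a⁻¹b · b⁻¹c = a⁻¹c; the extra gyration is harmless on
    gyration-invariant sets. *)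
Lemma gadd_chain a b c : (⊖ a ⊕ b) ⊕ gyr (⊖ a) b (⊖ b ⊕ c) = ⊖ a ⊕ c.
Proof. by rewrite -gaddA gaddNKl. Qed.

(** By [gadd_chain] with [c = a], the left side is a right inverse of [⊖ a ⊕ b]. *)
Lemma gyr_swap a b : gyr (⊖ a) b (⊖ b ⊕ a) = ⊖ (⊖ a ⊕ b).
Proof. by apply: (@gaddI (⊖ a ⊕ b)); rewrite gadd_chain gaddNl gaddNr. Qed.

Definition gyr_stable V := forall a b v, V v -> V (gyr a b v).

Lemma gyr_stable_gadd_set V W :
  gyr_stable V -> gyr_stable W -> gyr_stable (gadd_set V W).
Proof.
move=> sV sW a b _ [v Vv] [w Ww <-]; rewrite gyr_morph.
by exists (gyr a b v); [exact: sV|exists (gyr a b w); [exact: sW|]].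
Qed.

(* The sets [[set (a, b) | gball W a b]] play the role of the entourages of
   the left uniformity; gyration-invariance of [W] replaces associativity. *)
Definition gball W a : set G := [set b | W (⊖ a ⊕ b)].

Lemma gball_trans V W a b c : gyr_stable W ->
  gball V a b -> gball W b c -> gball (gadd_set V W) a c.
Proof.
move=> sW Vab Wbc; exists (⊖ a ⊕ b) => //.
by exists (gyr (⊖ a) b (⊖ b ⊕ c)); [exact: sW|rewrite gadd_chain].
Qed.

Lemma gball_sym W a b : gyr_stable W -> (@gopp G) @` W = W ->
  gball W a b -> gball W b a.
Proof.
move=> sW oW Wab; rewrite /gball/= -(goppK (⊖ b ⊕ a)) -oW.
by exists (⊖ (⊖ b ⊕ a)) => //; rewrite -gyr_swap; exact: sW.
Qed.

Lemma subgyrogroup0 H : subgyrogroup H -> H gzero.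
Proof. by move=> [[h Hh] HN HD]; rewrite -(gaddNl h); apply/HD => //; exact: HN. Qed.

Lemma coset_proj_eq H a b : subgyrogroup H ->
  coset_proj H a = coset_proj H b -> exists2 h, H h & b = a ⊕ h.
Proof.
move=> /subgyrogroup0 H0 /(congr1 val)/= ab.
have : left_coset b H b by exists gzero; rewrite // gadd0r.
by rewrite -ab => -[h Hh <-]; exists h.
Qed.

Lemma coset_proj_gadd H a h : subgyrogroup H ->
    (forall a b, gyr a b @` H = H) -> H h ->
  coset_proj H (a ⊕ h) = coset_proj H a.
Proof.
move=> [_ HN HD] gH Hh; apply/val_inj => /=; apply/seteqP; split => [_|_] [k Hk <-].
  (* Writing [k = gyr a h k'] with [k'] in [H] reassociates [(a ⊕ h) ⊕ k] to [a ⊕ (h ⊕ k')]. *)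
  have := Hk; rewrite -{1}(gH a h) => -[k' Hk' <-].
  by exists (h ⊕ k'); [exact: HD|rewrite gaddA].
exists (gyr a h (⊖ h ⊕ k)); last by rewrite -gaddA gaddNKl.
by rewrite -(gH a h); exists (⊖ h ⊕ k) => //; apply: HD => //; exact: HN.
Qed.

End Gyrogroup.

(** * Small neighborhoods and the openness of the coset projection *)

Section TopologicalGyrogroup.
Context (G : topGyrogroupType).
Implicit Types (a b x : G) (H N V W : set G) (UU : set (set G)).

Lemma continuous_gaddl a : continuous (gadd a : G -> G).
Proof.
move=> x; apply: (@continuous_comp _ _ _ (fun y => (a, y)) (fun z => z.1 ⊕ z.2)).
  by apply: cvg_pair => //; exact: cvg_cst.
exact: gadd_continuous.
Qed.

Lemma continuous_gaddr a : continuous (fun x : G => x ⊕ a).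
Proof.
move=> x; apply: (@continuous_comp _ _ _ (fun y => (y, a)) (fun z => z.1 ⊕ z.2)).
  by apply: cvg_pair => //; exact: cvg_cst.
exact: gadd_continuous.
Qed.

Lemma nbhs_gadd a b N : nbhs (a ⊕ b) N ->
  exists A B, [/\ nbhs a A, nbhs b B & gadd_set A B `<=` N].
Proof.
move=> /(@gadd_continuous G (a, b)) [[A B] [/= Aa Bb] AB].
by exists A, B; split=> // _ [x Ax] [y By <-]; exact: (AB (x, y)).
Qed.

Lemma nbhs_gball W a b : nbhs (⊖ a ⊕ b) W -> nbhs b (gball W a).
Proof. exact: continuous_gaddl. Qed.

Lemma nbhs_gball_self W a : nbhs gzero W -> nbhs a (gball W a).
Proof. by move=> W0; apply: nbhs_gball; rewrite gaddNl. Qed.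

Lemma strongly_stable UU W : strongly_topological UU -> UU W -> gyr_stable W.
Proof. by move=> [_ sU] /sU[_ gW] a b w Ww; rewrite -(gW a b); exists w. Qed.

Lemma strongly_nbhs UU W : strongly_topological UU -> UU W -> nbhs gzero W.
Proof. by move=> [[UUn _] _] /UUn. Qed.

Lemma strongly_half UU N : strongly_topological UU -> nbhs gzero N ->
  exists2 W, UU W & gadd_set W W `<=` N.
Proof.
move=> sU; rewrite -[X in nbhs X](gadd0l gzero) => /nbhs_gadd[A [B [A0 B0 AB]]].
have [W UW WAB] := sU.1.2 _ (filterI A0 B0).
exists W => // _ [v /WAB[Av _]] [w /WAB[_ Bw] <-].
by apply: AB; exists v => //; exists w.
Qed.

Lemma strongly_quarter UU N : strongly_topological UU -> nbhs gzero N ->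
  exists2 W, UU W & gadd_set (gadd_set W W) (gadd_set W W) `<=` N.
Proof.
move=> sU /(strongly_half sU)[V UV VN].
have [W UW WV] := strongly_half sU (strongly_nbhs sU UV).
exists W => // _ [v /WV Vv] [w /WV Vw <-].
by apply: VN; exists v => //; exists w.
Qed.

(** At a limit point [b], the [V]-balls about [a] and [b] meet; symmetry and the triangle inequality
    conclude. *)
Lemma closure_gball UU V N a : strongly_topological UU -> UU V ->
  gadd_set V V `<=` N -> closure (gball V a) `<=` gball N a.
Proof.
move=> sU UV VN b /(_ _ (nbhs_gball_self b (strongly_nbhs sU UV)))[c [Vac Vbc]].
have sV := strongly_stable sU UV.
apply: VN; apply: (gball_trans sV Vac).
by apply: gball_sym => //; exact: (sU.2 _ UV).1.
Qed.

Lemma admissible_gyr UU H a b : strongly_topological UU ->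
  admissible_subgyrogroup UU H -> gyr a b @` H = H.
Proof.
move=> sU [_ [U [Uo _ ->]]]; apply/seteqP; split => [_ [h Hh <-] n _|h Hh].
  by have [_ _ _ /(strongly_stable sU)] := Uo n; apply; exact: Hh.
have [g gK Kg] := gyr_bij a b; exists (g h) => // n _.
have [_ _ _ /sU.2[_ /(_ a b) gU]] := Uo n.
by have := Hh n I; rewrite -{1}gU => -[k Uk <-]; rewrite gK.
Qed.

Lemma continuous_coset_proj H : continuous (coset_proj H : G -> coset_space H).
Proof. by apply/continuousP => A /coset_openE. Qed.

(** The saturation of [A] is the union, over [h] in [H], of the preimages of [A] under right
    translation by [h], so continuity of these translations suffices. *)
Lemma open_coset_proj H (A : set G) : subgyrogroup H ->
    (forall a b, gyr a b @` H = H) ->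
  open A -> open (coset_proj H @` A : set (coset_space H)).
Proof.
move=> sH gH oA; apply/coset_openE.
suff -> : coset_proj H @^-1` (coset_proj H @` A) =
    \bigcup_(h in H) ((fun x => x ⊕ h) @^-1` A).
  apply: bigcup_open => h _; apply: open_comp => // x _.
  exact: continuous_gaddr.
apply/seteqP; split=> [x [a Aa /esym/(coset_proj_eq sH)[h Hh ax]]|x [h Hh Axh]].
  by exists h => //=; rewrite -ax.
by exists (x ⊕ h) => //; exact: coset_proj_gadd.
Qed.

End TopologicalGyrogroup.

(** * Compactness and finite covers by a network *)

Section Networks.
Context (X : topologicalType).
Implicit Types (A B K O : set X) (F : set (set X)).

(** Compactness as an induction principle: if [K] were not in the ideal [I], the sets [S] with
    [K \ S] in [I] would form a proper filter, whose cluster point in [K] contradicts the local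
    hypothesis. *)
Lemma compact_local_ideal (I : set (set X)) K :
    I set0 -> (forall A B, I A -> I B -> I (A `|` B)) ->
    (forall A B, A `<=` B -> I B -> I A) ->
    compact K -> (forall x, K x -> exists2 V, nbhs x V & I (K `&` V)) ->
  I K.
Proof.
move=> I0 IU IS cK Kloc; apply: contrapT => nIK.
pose F : set_system X := [set S | I (K `\` S)].
have FF : ProperFilter F.
  apply: Build_ProperFilter.
    by rewrite /F/= setD0.
  split; rewrite /F/=.
  - by rewrite setDT.
  - by move=> A B IA IB; rewrite /F/= setDIr; exact: IU.
  - by move=> A B AB; apply: IS; exact: setDS.
have FK : F K by rewrite /F/= setDv.
have [x [/Kloc[V xV IV] Fx]] := cK F FF FK.
have FV : F (~` V) by rewrite /F/= setDE setCK.
by have [y []] := Fx _ _ FV xV.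
Qed.

(** The conclusion of [k_network] for one set; for fixed [F] and [O] the sets [A] form an ideal, as
    [compact_local_ideal] requires. *)
Definition finitely_covered F O A := exists F' : set (set X),
  [/\ finite_set F', F' `<=` F, A `<=` \bigcup_(B in F') B
    & \bigcup_(B in F') B `<=` O].

Lemma finitely_covered_bigcup (T : Type) (D : set T) (A : T -> set X) F O :
  finite_set D -> (forall i, D i -> finitely_covered F O (A i)) ->
  finitely_covered F O (\bigcup_(i in D) A i).
Proof.
move=> finD cA.
have /choice[f fP] i : exists F', D i ->
    [/\ finite_set F', F' `<=` F, A i `<=` \bigcup_(B in F') B
      & \bigcup_(B in F') B `<=` O].
  by have [/cA[F' ?]|nDi] := pselect (D i); [exists F'|exists set0].
exists (\bigcup_(i in D) f i); split.
- by apply: bigcup_finite => // i /fP[].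
- by move=> B [i /fP[_ + _ _]]; exact.
- move=> x [i Di Aix]; have [_ _ /(_ _ Aix)[B fB Bx] _] := fP i Di.
  by exists B => //; exists i.
- move=> x [B [i Di fB] Bx]; have [_ _ _] := fP i Di; apply.
  by exists B.
Qed.

Lemma finitely_coveredS F O A B :
  A `<=` B -> finitely_covered F O B -> finitely_covered F O A.
Proof.
move=> AB [F' [? ? BF ?]]; exists F'; split => //.
exact: subset_trans BF.
Qed.

Lemma finitely_coveredU F O A B : finitely_covered F O A ->
  finitely_covered F O B -> finitely_covered F O (A `|` B).
Proof.
move=> cA cB; rewrite -bigcup2E.
suff : finitely_covered F O (\bigcup_(b in [set: bool]) if b then A else B).
  apply: finitely_coveredS => x; rewrite bigcup2E => -[Ax|Bx].
    by exists true.
  by exists false.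
by apply: finitely_covered_bigcup => // -[].
Qed.

Lemma finitely_covered1 F O A B :
  F B -> A `<=` B -> B `<=` O -> finitely_covered F O A.
Proof.
move=> FB AB BO; exists [set B]; split; rewrite ?bigcup_set1 //.
by move=> _ ->.
Qed.

Lemma finitely_covered0 F O : finitely_covered F O set0.
Proof. by exists set0; split=> //; rewrite bigcup_set0. Qed.

(** Singletons are compact, so a k-network is a network. *)
Lemma k_network_point F O x : k_network F -> open O -> O x ->
  exists B, [/\ F B, B x & B `<=` O].
Proof.
move=> kF oO Ox; have /(kF _ _ (@compact_set1 _ x) oO) : [set x] `<=` O by move=> _ ->.
move=> [F' [_ F'F /(_ x erefl)[B F'B Bx] F'O]]; exists B; split=> //.
  exact: F'F.
by move=> y By; apply: F'O; exists B.
Qed.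

End Networks.

(** * Countable dense sets and traces on a second-countable subset *)

Lemma second_countable_dense (X : topologicalType) : @second_countable X ->
  exists2 E : set X, countable E &
    forall O, open O -> O !=set0 -> O `&` E !=set0.
Proof.
move=> [B cB [_ Bb]].
have [[x0]|noX] := pselect (exists x : X, True); last first.
  by exists set0 => // O _ [x _]; exfalso; apply: noX; exists x.
have /choice[f fP] A : exists x : X, A !=set0 -> A x.
  by have [[x Ax]|nA] := pselect (A !=set0); [exists x|exists x0].
exists (f @` B).
  exact: sub_countable (card_image_le _ _) cB.
move=> O oO [x Ox]; have [A [BA Ax] AO] := Bb x _ (open_nbhs_nbhs (conj oO Ox)).
exists (f A); split; last by exists A.
by apply: AO; apply: fP; exists x.
Qed.

Lemma subspace_dense_countable (X : topologicalType) (H : set X) :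
  @second_countable (set_type H) ->
  exists E : set X, [/\ countable E, E `<=` H &
    forall O, open O -> O `&` H !=set0 -> O `&` E !=set0].
Proof.
move=> /second_countable_dense[E cE dE]; exists (val @` E); split.
- exact: sub_countable (card_image_le _ _) cE.
- by move=> _ [h _ <-]; exact: set_valP.
- move=> O oO [h [Oh Hh]].
  have [| |k [Ok Ek]] := dE (val @^-1` O).
  + by exists O.
  + by exists (exist _ h (mem_set Hh)).
  + by exists (val k); split=> //; exists k.
Qed.

(* Since [H] is second-countable, countably many members of [UU] suffice to
   control the trace on [H] of all neighborhoods of the identity. *)
Lemma countable_trace_base (G : topGyrogroupType) (UU : set (set G))
    (H : set G) : strongly_topological UU -> subgyrogroup H ->
    @second_countable (set_type H) ->
  exists WW : set (set G), [/\ countable WW, WW `<=` UU &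
    forall N, nbhs gzero N -> exists2 W, WW W &
      gadd_set (gadd_set W W) (gadd_set W W) `&` H `<=` N].
Proof.
move=> sU /subgyrogroup0 H0 [B cB [Bo Bb]].
pose e : set_type H := exist _ gzero (mem_set H0).
have /choice[f fP] : forall A, exists W, B A /\ A e ->
    UU W /\ gadd_set (gadd_set W W) (gadd_set W W) `&` H `<=` val @` A.
  move=> A.
  have [[BA Ae]|nA] := pselect (B A /\ A e); last by exists set0.
  have [Y oY YA] := Bo _ BA.
  have Y0 : Y gzero by move: Ae; rewrite -YA.
  have [W UW WY] := strongly_quarter sU (open_nbhs_nbhs (conj oY Y0)).
  exists W => _; split=> // h [/WY Yh Hh].
  by exists (exist _ h (mem_set Hh)) => //; rewrite -YA.
exists (f @` [set A | B A /\ A e]); split.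
- apply: sub_countable (card_image_le _ _) _.
  by apply: sub_countable cB; apply: subset_card_le => A [].
- by move=> _ [A /fP[UA _] <-].
- move=> N; rewrite nbhsE => -[Y [oY Y0] YN].
  have [|A [BA Ae] AY] := Bb e (val @^-1` Y).
    by apply: open_nbhs_nbhs; split => //; exists Y.
  exists (f A); first by exists A.
  move=> h /(fP A (conj BA Ae)).2[k Ak <-]; exact/YN/AY.
Qed.

(** * Lifting the k-network from the quotient *)

Section CosetNetwork.
Context (G : topGyrogroupType) (UU : set (set G)) (H : set G).
Context (P : set (set (coset_space H))).
Hypothesis G_strong : strongly_topological UU.
Hypothesis sH : subgyrogroup H.
Hypothesis gH : forall a b : G, gyr a b @` H = H.

(** [D] joins translates [g B ⊕ E], where [E] is dense in [H] and [g B] lies over a member [B]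
    meeting [A]. If [B] lies in the image of [O], the coset of [g B] meets [O], hence so does
    [g B ⊕ E]. Points of [D] need not lie over [A]. *)
Lemma network_preimage_dense (A : set (coset_space H)) :
    k_network P -> star_countable P -> P A -> @second_countable (set_type H) ->
  exists2 D : set G, countable D & forall x O, A (coset_proj H x) ->
    open O -> O x -> O `&` D !=set0.
Proof.
move=> kP sP PA /subspace_dense_countable[E [cE EH dE]].
have /choice[g gP] : forall B, exists y, A `&` B !=set0 -> B (coset_proj H y).
  move=> B; have [[b [_ Bb]]|nAB] := pselect (A `&` B !=set0).
    by exists (coset_repr b); rewrite coset_reprK.
  by exists gzero.
exists (\bigcup_(B in [set B | P B /\ A `&` B !=set0]) (gadd (g B) @` E)).
  apply: bigcup_countable; first exact: sP.
  move=> B _; exact: sub_countable (card_image_le _ _) cE.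
move=> x O Ax oO Ox.
have [B [PB Bx BO]] : exists B, [/\ P B, B (coset_proj H x)
    & B `<=` coset_proj H @` O].
  by apply: k_network_point => //; exact: open_coset_proj.
have AB : A `&` B !=set0 by exists (coset_proj H x).
have [c Oc /esym/(coset_proj_eq sH)[h Hh cE']] := BO _ (gP _ AB).
have [| |k [Ok Ek]] := dE (gadd (g B) @^-1` O).
- by apply: open_comp => // z _; exact: continuous_gaddl.
- by exists h; split; rewrite //= -cE'.
- by exists (g B ⊕ k); split => //; exists B => //; exists k.
Qed.

Definition cell (A : set (coset_space H)) y W : set G :=
  coset_proj H @^-1` A `&` gball W y.

(* A point [z] of the cell is [w ⊕ h] with [w] near [x]; the chain
   [w, x, x', y, z] of [W]-close points shows that [h] is small. *)
Lemma cell_subset (A : set (coset_space H)) (B N O W : set G) x x' y :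
    UU W -> gadd_set (gadd_set W W) (gadd_set W W) `&` H `<=` N ->
    gadd_set B N `<=` O -> A `<=` coset_proj H @` (B `&` gball W x) ->
    gball W x x' -> gball W y x' ->
  cell A y W `<=` O.
Proof.
move=> UW WN BNO AB Wxx' Wyx' z [/AB[w [Bw Wxw] /(coset_proj_eq sH)[h Hh ->]]] Wyz.
have sW := strongly_stable G_strong UW.
have oW := (G_strong.2 _ UW).1.
apply: BNO; exists w => //; exists h => //; apply: WN; split=> //.
rewrite -(gaddKl w h).
(* Cutting the chain at [x'] gives two links on each side, matching the bracketing in [WN]. *)
apply: (@gball_trans _ _ _ _ x'); first exact: gyr_stable_gadd_set.
  exact: gball_trans sW (gball_sym sW oW Wxw) Wxx'.
exact: gball_trans sW (gball_sym sW oW Wyx') Wyz.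
Qed.

Lemma cells_k_network (D : set (coset_space H) -> set G) (WW : set (set G)) :
    k_network P ->
    (forall A, P A -> forall x O, A (coset_proj H x) ->
      open O -> O x -> O `&` D A !=set0) ->
    WW `<=` UU ->
    (forall N, nbhs gzero N -> exists2 W, WW W &
      gadd_set (gadd_set W W) (gadd_set W W) `&` H `<=` N) ->
  k_network (\bigcup_(A in P) \bigcup_(y in D A) (cell A y @` WW)).
Proof.
move=> kP dD WWU trW K O cK oO KO; set F := \bigcup_(A in P) _.
apply: (@compact_local_ideal _ (finitely_covered F O)) => //.
- exact: finitely_covered0.
- by move=> A B; exact: finitely_coveredU.
- by move=> A B; exact: finitely_coveredS.
move=> x Kx.
have [B [N [xB N0 BNO]]] : exists B N, [/\ nbhs x B, nbhs gzero N
    & gadd_set B N `<=` O].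
  by apply: nbhs_gadd; rewrite gadd0r; exact/open_nbhs_nbhs/(conj oO)/KO.
have [W WWW WN] := trW _ N0.
have W0 := strongly_nbhs G_strong (WWU _ WWW).
(* The image of the open set [C] is the open target offered to [P], so that every chosen [A]
   satisfies the hypothesis of [cell_subset]. *)
pose C := interior (B `&` gball W x).
have xC : nbhs gzero [set v | C (x ⊕ v)].
  apply: continuous_gaddl; rewrite gadd0r; apply: nbhs_interior.
  by apply: filterI => //; exact: nbhs_gball_self.
have [V UV VC] := strongly_half G_strong xC.
exists (gball V x).
  exact: nbhs_gball_self (strongly_nbhs G_strong UV).
(* The closure keeps [L] compact; [V] was halved so that the closed ball still fits in [C]. *)
pose L := K `&` closure (gball V x).
have LC : L `<=` C.
  move=> z [_ /(closure_gball G_strong UV VC)].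
  by rewrite /gball/= gaddNKl.
have cL : compact L by by apply: compact_closedI => //; exact: closed_closure.
have [P' [finP' P'P LP' P'C]] : finitely_covered P (coset_proj H @` C) (coset_proj H @` L).
  apply: kP.
  - apply: continuous_compact => //.
    by apply: continuous_subspaceT => z; exact: continuous_coset_proj.
  - by apply: open_coset_proj => //; exact: open_interior.
  - exact: image_subset.
apply: (@finitely_coveredS _ _ _ _
    (\bigcup_(A in P') (L `&` coset_proj H @^-1` A))).
  move=> z [Kz Vz]; have Lz : L z by split => //; exact: subset_closure.
  by have [A P'A Az] := LP' _ (imageP _ Lz); exists A.
apply: finitely_covered_bigcup => // A P'A.
have AC : A `<=` coset_proj H @` (B `&` gball W x).
  move=> a Aa; have [|c Cc <-] := P'C a; first by exists A.
  by exists c => //; exact: interior_subset.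
(* The part of [L] over [A] may fail to be compact, so the induction runs on [L] with an ideal that
   only looks at points over [A]. *)
apply: (@compact_local_ideal _
    (fun S => finitely_covered F O (S `&` coset_proj H @^-1` A))) => //.
- by rewrite set0I; exact: finitely_covered0.
- by move=> S T; rewrite setIUl; exact: finitely_coveredU.
- by move=> S T ST; apply: finitely_coveredS; exact: setSI.
move=> x' Lx'.
(* Candidate centers [y]; the interior makes [gball W y] a neighborhood of [x']. *)
pose S : set G := [set y | interior W (⊖ y ⊕ x')].
have oS : open S.
  apply: (@open_comp _ _ (fun y : G => ⊖ y ⊕ x')); last exact: open_interior.
  move=> y _; apply: (@continuous_comp _ _ _ _ (fun v : G => v ⊕ x')).
    exact: gopp_continuous.
  exact: continuous_gaddr.
have Sx' : S x' by rewrite /S/= gaddNl.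
(* [x'] itself may not lie over [A]: density of [D A] is used at another point [z] of [S] over [A],
   and without such a point [S] leaves nothing to cover. *)
have [[z [Sz Az]]|nA] := pselect (S `&` coset_proj H @^-1` A !=set0).
  have [y [Wyx' Dy]] := dD _ (P'P _ P'A) z S Az oS Sz.
  exists (gball W y); first by apply: nbhs_gball.
  apply: (@finitely_covered1 _ _ _ _ (cell A y W)).
  - by exists A; [exact: P'P|exists y => //; exists W].
  - by move=> v [[_ Wyv] Av].
  - apply: (cell_subset (WWU _ WWW) WN BNO AC) (interior_subset Wyx').
    exact: (interior_subset (LC _ Lx')).2.
exists S; first exact: open_nbhs_nbhs.
apply: (finitely_coveredS (B := set0)); last exact: finitely_covered0.
by move=> v [[_ Sv] Av]; apply: nA; exists v.
Qed.

(** A common point of two cells projects into both [A] and [B], which leaves countably many [B],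
    centers and radii. *)
Lemma cells_star_countable (D : set (coset_space H) -> set G)
    (WW : set (set G)) :
    star_countable P -> countable WW -> (forall A, P A -> countable (D A)) ->
  star_countable (\bigcup_(A in P) \bigcup_(y in D A) (cell A y @` WW)).
Proof.
move=> sP cWW cD _ [A PA [y _ [W _ <-]]].
apply: (@sub_countable _ _ _ (\bigcup_(B in [set B | P B /\ A `&` B !=set0])
    \bigcup_(z in D B) (cell B z @` WW))).
  apply: subset_card_le => _ [[B PB [z Dz [V WWV <-]]] [v [[Av _] [Bv _]]]].
  exists B; first by split => //; exists (coset_proj H v).
  by exists z => //; exists V.
apply: bigcup_countable => [|B [PB _]]; first exact: sP.
apply: bigcup_countable => [|z _]; first exact: cD.
exact: sub_countable (card_image_le _ _) cWW.
Qed.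

End CosetNetwork.

Theorem theorem3p13 (G : topGyrogroupType) (UU : set (set G)) (H : set G)
    (G_hausdorff : hausdorff_space G)
    (G_strong : strongly_topological UU)
    (H_admissible : admissible_subgyrogroup UU H)
    (H_second_countable : @second_countable (set_type H))
    (GH_network : has_star_countable_k_network (coset_space H)) :
  has_star_countable_k_network G.
Proof.
have [P [kP sP]] := GH_network.
have sH := H_admissible.1.
have gH a b : gyr a b @` H = H := admissible_gyr a b G_strong H_admissible.
have [WW [cWW WWU trW]] := countable_trace_base G_strong sH H_second_countable.
have /choice[D DP] : forall A, exists E : set G, P A -> countable E /\
    forall x O, A (coset_proj H x) -> open O -> O x -> O `&` E !=set0.
  move=> A; have [PA|nPA] := pselect (P A); last by exists set0.
  have [E cE dE] := network_preimage_dense sH gH kP sP PA H_second_countable.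
  by exists E.
exists (\bigcup_(A in P) \bigcup_(y in D A) (cell A y @` WW)); split.
  by apply: (cells_k_network G_strong) => // A /DP[].
by apply: cells_star_countable => // A /DP[].
Qed.
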